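(* For any finite abelian group $(G,+)$, let $\Phi_{H_{\mathrm{cor},G}}$ be the support of the adjacency tensor of $H_{\mathrm{cor},G}$. Then $\Phi_{H_{\mathrm{cor},G}}$ is tight.
   Context: $H_{\mathrm{cor},G}$ is the directed $3$-uniform hypergraph with vertex set $V=G\times G$ and edges $((g_1,g_2),(g_1+\lambda,g_2),(g_1,g_2+\lambda))$ for $g_1,g_2,\lambda\in G$, $\lambda\neq0$. The support of its adjacency tensor is $\Phi_{H_{\mathrm{cor},G}}=E\cup\{(v,v,v):v\in V\}\subseteq V\times V\times V$. A subset $\Phi\subseteq I_1\times\dots\times I_k$ of a product of finite sets is tight if there are injective maps $u_i:I_i\to\mathbb{Z}$ ($i\in[k]$) with $u_1(a_1)+\dots+u_k(a_k)=0$ for every $(a_1,\dots,a_k)\in\Phi$. *)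

(* Defs.v *)
From HB Require Import structures.
From mathcomp Require Import all_boot all_order all_algebra.

Set Implicit Arguments.
Unset Strict Implicit.
Unset Printing Implicit Defensive.

Import GRing.Theory.
Local Open Scope ring_scope.

(* Elements of I_1 x ... x I_k are finite dependent functions on 'I_k; the
   power V^k is the case of a constant family. *)
Definition tight (k : nat) (I : 'I_k -> finType)
    (Phi : {set {dffun forall i, I i}}) : Prop :=
  exists u : forall i, I i -> int,
    (forall i, injective (u i)) /\
    (forall a, a \in Phi -> \sum_(i < k) u i (a i) = 0).

Record dhypergraph (k : nat) := DHypergraph {
  vertex : finType;
  edges : {set {dffun forall _ : 'I_k, vertex}}
}.

Definition diag (k : nat) (V : finType) (v : V) : {dffun forall _ : 'I_k, V} :=
  [ffun=> v].

Definition triple (V : finType) (a b c : V) : {dffun forall _ : 'I_3, V} :=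
  [ffun i => tnth [tuple a; b; c] i].

Definition adj_support (k : nat) (H : dhypergraph k) :
    {set {dffun forall _ : 'I_k, vertex H}} :=
  edges H :|: [set diag k v | v : vertex H].

Definition adj_tensor (F : fieldType) (k : nat) (H : dhypergraph k)
    (t : {dffun forall _ : 'I_k, vertex H}) : F :=
  if (t \in edges H) || [exists v, t == diag k v] then 1 else 0.

Lemma adj_supportE (F : fieldType) (k : nat) (H : dhypergraph k) :
  adj_support H = [set t | adj_tensor F t != 0].
Proof.
apply/setP=> t; rewrite !inE /adj_tensor.
have -> : (t \in [set diag k v | v : vertex H]) = [exists v, t == diag k v].
  apply/imsetP/existsP => [[v _ ->]|[v /eqP ->]]; first by exists v.
  by exists v.
by case: ifP => _; rewrite ?oner_eq0 ?eqxx.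
Qed.

Definition corner (G : finZmodType) (g1 g2 l : G) :
    {dffun forall _ : 'I_3, (G * G)%type} :=
  triple (g1, g2) (g1 + l, g2) (g1, g2 + l).

Definition Hcor (G : finZmodType) : dhypergraph 3 :=
  @DHypergraph 3 (G * G)%type
    [set corner p.1.1 p.1.2 p.2 | p : (G * G) * G & p.2 != 0].

(* Main.v *)
Require Import Defs.
From mathcomp Require Import all_boot all_order all_algebra.
From mathcomp Require Import zify.

Set Implicit Arguments.
Unset Strict Implicit.
Unset Printing Implicit Defensive.

Import GRing.Theory.
Local Open Scope ring_scope.

(** Put [s = g1 + g2 + l]. A corner is then the triple of points determined by
    the pairs [(g1, g2)], [(g2, s)] and [(g1, s)], with [l = 0] giving the
    diagonal triples. Hence for arbitrary maps [x, y, z : G -> int] the weights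
    [x g1 + y g2], [z s - y g2] and [- x g1 - z s] sum to zero on the support.
    Enumerating [G] by [n] with values below [N = #|G|], the choice [x = n],
    [y = N n], [z = N^2 n] makes all three weights injective, by uniqueness of
    digits in base [N] or [N^2]. *)

Lemma radix_inj (M x x' y y' : nat) : (x < M -> x' < M ->
  x + M * y = x' + M * y' -> x = x' /\ y = y')%N.
Proof.
move=> ltxM ltx'M eqxy.
have M_gt0 : (0 < M)%N by apply: leq_ltn_trans ltxM.
have eqx : x = x'.
  have := congr1 (modn^~ M) eqxy.
  by rewrite ![(_ + M * _)%N]addnC ![(M * _)%N]mulnC !modnMDl !modn_small.
split=> //; move: eqxy; rewrite eqx => /addnI /eqP.
by rewrite eqn_pmul2l // => /eqP.
Qed.

Section CornerWeights.

Variable G : finZmodType.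
Implicit Types (g s l : G) (v : G * G).

Let N : nat := #|G|.
Let n g : nat := enum_rank g.

Let n_lt g : (n g < N)%N. Proof. exact: ltn_ord. Qed.

Let n_inj : injective n.
Proof. by move=> g g' /val_inj /enum_rank_inj. Qed.

Definition corner_weight (i : 'I_3) v : int :=
  let s := v.1 + v.2 in
  match val i with
  | 0 => (n v.1 + N * n v.2)%N%:Z
  | 1 => (N * (N * n s))%N%:Z - (N * n v.2)%N%:Z
  | _ => - (n v.1 + N * N * n s)%N%:Z
  end.

Lemma corner_weight_inj i : injective (corner_weight i).
Proof.
have N_gt0 : (0 < N)%N by apply: leq_ltn_trans (n_lt 0).
case: i => [[|[|[|//]]] lti3] [a b] [a' b']; rewrite /corner_weight /=.
- by case=> /radix_inj[] // /n_inj-> /n_inj->.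
- move=> eq_w.
  (* Moving the subtracted terms across turns [eq_w] into an equality of naturals; after cancelling
     [N], [n b] and [n b'] are the low digits in base [N]. *)
  have /eqP : (N * (n b + N * n (a' + b')%R) = N * (n b' + N * n (a + b)%R))%N.
    by rewrite !mulnDr; lia.
  rewrite eqn_pmul2l // => /eqP /radix_inj[] // /n_inj-> /n_inj.
  by move/addIr->.
(* Here the base is [N * N], so the low digit needs this weaker bound. *)
- have n_ltNN g : (n g < N * N)%N.
    by apply: leq_trans (n_lt g) _; rewrite leq_pmulr.
  by move/oppr_inj; case=> /radix_inj[] // /n_inj-> /n_inj /addrI->.
Qed.

Lemma corner_weight_sum g1 g2 l :
  \sum_(i < 3) corner_weight i (corner g1 g2 l i) = 0.
Proof.
rewrite !big_ord_recl big_ord0 /corner_weight !ffunE /=.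
(* Both sums become [g1 + g2 + l], so [lia] sees a single atom [n s], which cancels. *)
by rewrite (addrAC g1 l g2) (addrA g1 g2 l); lia.
Qed.

End CornerWeights.

Lemma diag_corner (G : finZmodType) (v : G * G) : diag 3 v = corner v.1 v.2 0.
Proof.
case: v => a b; apply/ffunP=> i.
by rewrite !ffunE /= !addr0; case: i => [[|[|[|//]]]].
Qed.

Theorem theorem3p5 (G : finZmodType) : tight (adj_support (Hcor G)).
Proof.
exists (@corner_weight G); split=> [i|a]; first exact: corner_weight_inj.
rewrite inE => /orP[|] /imsetP[v _ ->]; last rewrite diag_corner.
all: exact: corner_weight_sum.
Qed.
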